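(* There is an absolute constant $c > 0$ such that the following holds. Consider the universal emptying game on $p$ processors and $n$ cups, and let $k$ be a multiple of $p$ with $2p \le k \le n$. For every (possibly randomized) emptier, there is an oblivious filler strategy which, with probability at least $$\left(\frac{1}{\binom{k}{p}}\right)^{k/p - 1} \ge \frac{1}{k^k},$$ ensures that after step $\frac{k}{p} - 1$ some cup contains at least $c \log\frac{k}{p}$ units of water.
   Context: Universal emptying game on $p$ processors and $n$ cups: $n$ cups, initially empty. In each step the filler distributes $p/2$ units of water among the cups (no per-cup limit), and then the emptier selects $p$ cups and removes all of the water from each. An oblivious filler fixes its pouring in advance without seeing which cups the emptier has emptied. *)

(* Defs.v *)
From HB Require Import structures.
From mathcomp Require Import all_boot all_order all_algebra.
From mathcomp Require Import all_classical all_reals all_analysis.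
Set Implicit Arguments.
Unset Strict Implicit.
Unset Printing Implicit Defensive.
Import Order.TTheory GRing.Theory Num.Theory.
Local Open Scope classical_set_scope.
Local Open Scope ring_scope.

(** The universal emptying game on [p] processors and [n] cups.  Steps are
    numbered from 0 here, so that "after step [t]" in the usual numbering from
    1 is the state after [t] rounds. *)

Definition pour (R : realType) (n : nat) := 'I_n -> R.

Definition legal_pour (R : realType) (n p : nat) (x : pour R n) : Prop :=
  (forall i, 0 <= x i) /\ \sum_(i < n) x i = p%:R / 2.

(** An oblivious filler fixes the whole sequence of pours before the game.  It
    is deterministic: a randomized oblivious filler is a mixture of such
    sequences, so the existence of a single good one is the strongest form of
    an existence claim about oblivious fillers. *)
Record oblivious_filler (R : realType) (n p : nat) := ObliviousFiller {
  pouring :> nat -> pour R n;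
  pouring_legal : forall t, legal_pour p (pouring t) }.

(** A randomized emptier is a random deterministic online strategy: once its
    random outcome [w] is drawn, the cups emptied in a step are a function of
    the pours made so far, the current one included.  Its own past moves, and
    hence all the fills, are determined by [w] and these pours.  The sample
    space is arbitrary; deterministic emptiers do not depend on [w]. *)
Record emptier (R : realType) (n p : nat) (d : measure_display)
    (T : measurableType d) := Emptier {
  emptied :> T -> seq (pour R n) -> {set 'I_n};
  emptied_card : forall w h, #|emptied w h| = p;
  emptied_measurable : forall h (S : {set 'I_n}),
    measurable [set w | emptied w h = S] }.

(** The water in each cup after [t] rounds, when the filler pours [f 0],
    [f 1], etc., and the emptier plays the online strategy [e]. *)
Fixpoint water (R : realType) (n : nat) (e : seq (pour R n) -> {set 'I_n})
    (f : nat -> pour R n) (t : nat) : pour R n :=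
  if t is s.+1 then
    fun i => if i \in e (mkseq f s.+1) then 0 else water e f s i + f s i
  else fun=> 0.

(* Main.v *)
(** The filler keeps a set [A] of active cups, [k] of them at first, and in each
    step pours evenly on [A].  Some [p]-subset [S] of [A] contains every active
    cup that the emptier empties.  There are at most ['C(k, p)] candidates for
    [S], so some fixed one is right with conditional probability at least
    [1 / 'C(k, p)]; when it is, removing it from [A] leaves cups that have
    never been emptied.  Choosing such an [S] greedily at every step, rather
    than a random one, makes the filler deterministic.  With [m = k / p], the cups that survive
    [m - 1] steps hold [1/(2m) + 1/(2(m-1)) + ... + 1/4] units, which is of
    order [ln m]. *)
Require Import Defs.
From HB Require Import structures.
From mathcomp Require Import all_boot all_order all_algebra.
From mathcomp Require Import ring lra.
From mathcomp Require Import all_classical all_reals all_analysis.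
Set Implicit Arguments.
Unset Strict Implicit.
Unset Printing Implicit Defensive.
Import Order.TTheory GRing.Theory Num.Theory.
Local Open Scope classical_set_scope.
Local Open Scope ring_scope.

(** Causality: the emptier is online, so later pours cannot influence earlier fills. This is what
    allows a filler to be revised one round at a time. *)
Lemma water_ext (R : realType) (n : nat) (e : seq (pour R n) -> {set 'I_n})
    (f g : nat -> pour R n) (t : nat) :
  (forall s, (s < t)%N -> f s = g s) -> water e f t = water e g t.
Proof.
elim: t => [//|t IH] fg /=.
have -> : mkseq f t.+1 = mkseq g t.+1.
  by apply/eq_in_map => s; rewrite mem_iota => /andP[_ st]; exact: fg.
by rewrite IH ?fg // => s st; apply: fg; exact: ltnW.
Qed.

Lemma measurable_water (R : realType) (n p : nat) (d : measure_display)
    (T : measurableType d) (e : emptier R n p T) (f : nat -> pour R n)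
    (t : nat) (i : 'I_n) :
  measurable_fun setT (fun w => water (e w) f t i).
Proof.
elim: t => [|t IH] /=; first exact: measurable_cst.
apply: measurable_fun_ifT; [|exact: measurable_cst|exact: measurable_realfun.measurable_funD].
apply: (measurable_fun_bool true); rewrite setTI.
(* The emptied set has finitely many possible values, so the event that cup [i] is emptied is a
   finite union of events covered by [emptied_measurable]. *)
rewrite (_ : _ @^-1` _ = \bigcup_(S in [set S : {set 'I_n} | i \in S])
    [set w | e w (mkseq f t.+1) = S]).
  by apply: fin_bigcup_measurable => // S _; exact: emptied_measurable.
apply/seteqP; split => w /=; first by move=> iS; exists (e w (mkseq f t.+1)).
by move=> [S /= iS ->].
Qed.

Lemma measurable_water_ge (R : realType) (n p : nat) (d : measure_display)
    (T : measurableType d) (e : emptier R n p T) (f : nat -> pour R n)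
    (t : nat) (i : 'I_n) (v : R) :
  measurable [set w | v <= water (e w) f t i].
Proof.
rewrite -[X in measurable X]setTI; rewrite (_ : [set w | _] =
    (fun w => water (e w) f t i) @^-1` `[v, +oo[%classic).
  by apply: measurable_water => //; exact: measurable_itv.
by apply/seteqP; split => w /=; rewrite in_itv /= andbT.
Qed.

Lemma measurable_water_ge_on (R : realType) (n p : nat) (d : measure_display)
    (T : measurableType d) (e : emptier R n p T) (f : nat -> pour R n)
    (t : nat) (A : {set 'I_n}) (v : R) :
  measurable [set w | forall i, i \in A -> v <= water (e w) f t i].
Proof.
rewrite (_ : [set w | _] = \bigcap_(i in [set i | i \in A])
    [set w | v <= water (e w) f t i]) //.
by apply: fin_bigcap_measurable => // i _; exact: measurable_water_ge.
Qed.

(** Union bound: the [F i] with [i] in [D] cover [E], so the most probable of them has at least the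
    average share. *)
Lemma probability_pigeonhole (R : realType) (d : measure_display)
    (T : measurableType d) (P : probability T R) (I : finType) (D : {set I})
    (E : set T) (F : I -> set T) (x : R) :
  (0 < #|D|)%N -> measurable E -> (forall i, measurable (F i)) ->
  (forall w, E w -> exists2 i, i \in D & F i w) ->
  (x%:E <= P E)%E ->
  exists2 i, i \in D & ((x / #|D|%:R)%:E <= P (F i))%E.
Proof.
move=> D0 mE mF EF xE; have /card_gt0P[i0 i0D] := D0.
have [i iD imax] := @arg_maxP _ _ _ _ [in D] (fun i => fine (P (F i))) i0D.
exists i => //.
have Pfin A : measurable A -> P A = (fine (P A))%:E.
  by move=> mA; rewrite fineK //; exact: fin_num_measure.
have union_bound : (P (\big[setU/set0]_(j in D) F j)
    <= \sum_(j in D) P (F j))%E.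
  (* Measurability of the partial union is carried through the induction, since subadditivity for
     two sets requires it. *)
  suff [] : (P (\big[setU/set0]_(j in D) F j) <= \sum_(j in D) P (F j))%E
    /\ measurable (\big[setU/set0]_(j in D) F j) by [].
  elim/big_rec2: _ => [|j y B _ [By mB]]; first by rewrite measure0.
  split; last exact: measurableU.
  by apply: le_trans (measureU2 _ _ _) _ => //; exact: leeD2l.
have EU : (P E <= P (\big[setU/set0]_(j in D) F j))%E.
  apply: le_measure; rewrite ?inE //; first exact: bigsetU_measurable.
  by move=> w /EF[j jD Fj]; rewrite (bigD1 j) //=; left.
rewrite Pfin // lee_fin ler_pdivrMr ?ltr0n // mulr_natr -lee_fin.
apply: le_trans xE (le_trans EU (le_trans union_bound _)).
rewrite (eq_bigr (fun j => (fine (P (F j)))%:E)); last by move=> j _; exact: Pfin.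
rewrite sumEFin lee_fin -sumr_const; apply: ler_sum => j jD; exact: imax.
Qed.

Lemma subset_extend (T : finType) (E A : {set T}) (p : nat) :
  E \subset A -> (#|E| <= p <= #|A|)%N ->
  exists S : {set T}, [/\ E \subset S, S \subset A & #|S| = p].
Proof.
move=> EA /andP[Ep pA].
have : (0 < #|[set B : {set T} | B \subset A :\: E & #|B| == (p - #|E|)%N]|)%N.
  by rewrite cards_draws bin_gt0 cardsDS // leq_sub2r.
case/card_gt0P => B; rewrite inE subsetD => /andP[/andP[BA BE] /eqP cB].
exists (E :|: B); split; first exact: finset.subsetUl.
  by rewrite finset.subUset EA.
by rewrite cardsU finset.disjoint_setI0 1?disjoint_sym // cards0 subn0 cB subnKC.
Qed.

Definition uniform_pour (R : realType) (n p : nat) (A : {set 'I_n}) : pour R n :=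
  fun i => if i \in A then p%:R / 2 / #|A|%:R else 0.

Lemma uniform_pour_legal (R : realType) (n p : nat) (A : {set 'I_n}) :
  (0 < #|A|)%N -> legal_pour p (uniform_pour R p A).
Proof.
move=> A0; split=> [i|].
  by rewrite /uniform_pour; case: ifP => // _; rewrite !divr_ge0.
rewrite -big_mkcond /= sumr_const -[LHS]mulr_natr divfK //.
by rewrite pnatr_eq0 -lt0n.
Qed.

(** Induction on [t]. The event bounds the fills on [A] instead of recording which cups were
    emptied, which is all that the next averaging step needs. The filler may depend on [e] and [P],
    but not on the outcome [w]. *)
Lemma greedy_filler (R : realType) (n p m : nat) (d : measure_display)
    (T : measurableType d) (P : probability T R) (e : emptier R n p T)
    (t : nat) : (0 < p)%N -> (m * p <= n)%N -> (t < m)%N ->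
  exists (f : oblivious_filler R n p) (A : {set 'I_n}),
    #|A| = ((m - t) * p)%N /\
    ((('C(m * p, p))%:R^-1 ^+ t)%R%:E <=
      P [set w | forall i, i \in A ->
           (\sum_(s < t) (2 * (m - s)%:R)^-1 <= water (e w) f t i)%R])%E.
Proof.
move=> p0 mpn; elim: t => [m0|t IH tm].
  have [A [_ _ cA]] : exists A : {set 'I_n},
      [/\ finset.set0 \subset A, A \subset [set: 'I_n]%SET & #|A| = (m * p)%N].
    by apply: subset_extend; rewrite ?finset.sub0set // cards0 cardsT card_ord mpn.
  have A0 : (0 < #|A|)%N by rewrite cA muln_gt0 m0.
  (* No round has been played yet, so any legal sequence of pours would do. *)
  exists (ObliviousFiller (fun=> uniform_pour_legal R p A0)), A.
  rewrite subn0; split=> //; rewrite expr0 (_ : [set w | _] = setT).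
    by rewrite probability_setT.
  by apply/seteqP; split => w // _ i _; rewrite big_ord0.
have [f [A [cA PA]]] := IH (ltnW tm).
have A0 : (0 < #|A|)%N by rewrite cA muln_gt0 subn_gt0 ltnW.
(* Only the pour of round [t] changes. It depends on [A] alone, so the set [S] to discard can be
   chosen afterwards, by averaging over the outcomes. *)
pose g s := if s == t then uniform_pour R p A else f s.
have g_legal s : legal_pour p (g s).
  rewrite /g; case: ifP => _; first exact: uniform_pour_legal.
  exact: pouring_legal.
pose D := [set S : {set 'I_n} | S \subset A & #|S| == p].
have cD : #|D| = 'C((m - t) * p, p) by rewrite cards_draws cA.
have pA : (p <= #|A|)%N by rewrite cA leq_pmull // subn_gt0 ltnW.
have D0 : (0 < #|D|)%N by rewrite cD bin_gt0 -cA.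
pose v u : R := \sum_(s < u) (2 * (m - s)%:R)^-1.
have gE : (fun w => water (e w) g t) = (fun w => water (e w) f t).
  apply/funext => w; apply: water_ext => s st.
  by rewrite /g ltn_eqF.
have [] := @probability_pigeonhole _ _ _ P _ D
    [set w | forall i, i \in A -> v t <= water (e w) f t i]
    (fun S => [set w | forall i, i \in A :\: S -> v t.+1 <= water (e w) g t.+1 i])
    _ D0 _ _ _ PA.
- exact: measurable_water_ge_on.
- by move=> S; exact: measurable_water_ge_on.
- move=> w /= wA; set E := e w (mkseq g t.+1).
  (* The emptier may hit fewer than [p] active cups; padding to exactly [p] makes the candidates
     [p]-subsets of [A] and the size of the next active set deterministic. *)
  have [|S [ES SA cS]] := @subset_extend _ (E :&: A) A p (finset.subsetIr _ _).
    by rewrite pA andbT -(emptied_card e w (mkseq g t.+1)) subset_leq_card ?finset.subsetIl.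
  exists S; first by rewrite inE SA cS eqxx.
  move=> i; rewrite inE => /andP[iS iA].
  rewrite -/E ifN; last first.
    by apply: contra iS => iE; apply: (fintype.subsetP ES); rewrite inE iE.
  rewrite (congr1 (fun h => h w i) gE) /v big_ord_recr /= lerD ?wA //.
  (* Sharing [p / 2] units among [(m - t) * p] cups gives each [1 / (2 (m - t))], the new
     summand. *)
  rewrite /g eqxx /uniform_pour iA cA natrM.
  rewrite [X in _ <= X](_ : _ = (2 * (m - t)%:R)^-1) //.
  by field; rewrite !pnatr_eq0 subn_eq0 -ltnNge ltnW // -lt0n.
move=> S; rewrite inE => /andP[SA /eqP cS] PS.
exists (ObliviousFiller g_legal), (A :\: S); split.
  by rewrite cardsDS // cS cA -[X in (_ - X)%N]mul1n -mulnBl -subnDA addn1.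
(* The loss in this round is ['C((m - t) * p, p)], at most the uniform factor ['C(m * p, p)]. *)
apply: le_trans PS; rewrite lee_fin cD exprSr ler_wpM2l ?exprn_ge0 ?invr_ge0 //.
rewrite lef_pV2 ?posrE ?ltr0n ?bin_gt0 -?cA //.
  by rewrite ler_nat cA leq_bin2l // leq_mul2r leq_subr orbT.
by apply: leq_trans pA _; rewrite cA leq_mul2r leq_subr orbT.
Qed.

(** From [m] to [m + 1] the logarithm grows by [ln (1 + 1/(m+1)) <= 1/(m+1)], while the sum gains
    [1/(2(m+2))]. The factor [1/4] suffices because [m + 2 <= 2(m + 1)]. *)
Lemma ln_le_harmonic (R : realType) (m : nat) :
  4^-1 * ln (m.+1%:R) <= \sum_(s < m) (2 * (m.+1 - s)%:R)^-1 :> R.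
Proof.
elim: m => [|m IH]; first by rewrite big_ord0 ln1 mulr0.
rewrite big_ord_recl subn0.
rewrite (eq_bigr (fun s : 'I_m => (2 * (m.+1 - s)%:R)^-1)); last by [].
have -> : m.+2%:R = m.+1%:R * (1 + m.+1%:R^-1) :> R.
  by rewrite mulrDr mulfV ?mulr1 ?pnatr_eq0 // natr1.
have m0 : 0 < m.+1%:R :> R by rewrite ltr0n.
rewrite lnM ?posrE // ?addr_gt0 ?invr_gt0 // mulrDr addrC lerD //.
have : ln (1 + m.+1%:R^-1) <= m.+1%:R^-1 :> R.
  by apply: le_ln1Dx; rewrite (lt_trans (ltrN10 _)) // invr_gt0.
move=> /(ler_wpM2l (_ : 0 <= 4^-1)) -/(_ _) h; apply: le_trans (h _) _; first by [].
rewrite -invfM mulrDr mulr1 mulfV ?gt_eqF // lef_pV2 ?posrE ?mulr_gt0 ?addr_gt0 //.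
have : 1 <= m.+1%:R :> R by rewrite ler1n.
lra.
Qed.

Lemma leq_bin_exp (n k : nat) : ('C(n, k) <= n ^ k)%N.
Proof.
apply: (@leq_trans (n ^_ k)).
  by rewrite -bin_ffact leq_pmulr // fact_gt0.
elim: k => [|k IH]; first by rewrite ffactn0 expn0.
by rewrite ffactnSr expnSr leq_mul // leq_subr.
Qed.

Theorem theorem8p3 (R : realType) :
  exists2 c : R, 0 < c &
    forall n p k : nat, (0 < p)%N -> (p %| k)%N -> (2 * p <= k <= n)%N ->
    (forall (d : measure_display) (T : measurableType d) (P : probability T R)
        (e : emptier R n p T),
      exists f : oblivious_filler R n p,
        (P [set w | exists i : 'I_n,
              (c * ln (k %/ p)%:R <= water (e w) f (k %/ p - 1) i)%R]
         >= ((('C(k, p))%:R^-1 ^+ (k %/ p - 1))%R)%:E)%E)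
    /\ ('C(k, p))%:R^-1 ^+ (k %/ p - 1) >= (k ^ k)%:R^-1 :> R.
Proof.
exists 4^-1; first by rewrite invr_gt0.
move=> n p k p0 /dvdnP[m ->] /andP[]; rewrite leq_pmul2r // mulnK // => m2 mpn.
split=> [d T P e|].
  have m1 : (m - 1 < m)%N by rewrite ltn_subrL (ltnW m2).
  have [f [A [cA PA]]] := greedy_filler P e p0 mpn m1.
  exists f; apply: le_trans PA _.
  apply: le_measure; rewrite ?inE; first exact: measurable_water_ge_on.
    rewrite (_ : [set w | _] = \bigcup_(i in [set: 'I_n])
        [set w | 4^-1 * ln m%:R <= water (e w) f (m - 1) i]).
      by apply: fin_bigcup_measurable => // i _; exact: measurable_water_ge.
    by apply/seteqP; split => w /= [i]; [exists i | move=> _; exists i].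
  (* After [m - 1] rounds exactly [p] active cups remain; any one of them is a witness. *)
  have /card_gt0P[i iA] : (0 < #|A|)%N by rewrite cA subKn ?mul1n // ltnW.
  move=> w /= wA; exists i; apply: le_trans (wA i iA).
  have := ln_le_harmonic R (m - 1).
  by rewrite subn1 prednK // ltnW.
rewrite exprVn -natrX lef_pV2 ?posrE ?ltr0n ?expn_gt0 ?bin_gt0 ?muln_gt0.
(* With [k = m * p], bounding the binomial by [k ^ p] leaves the exponent [p * (m - 1)], which is at
   most [k]. *)
- rewrite ler_nat; apply: (@leq_trans (((m * p) ^ p) ^ (m - 1))).
    by rewrite leq_exp2r ?subn_gt0 // leq_bin_exp.
  rewrite -expnM leq_pexp2l ?muln_gt0 ?p0 ?(ltnW m2) //.
  by rewrite mulnBr muln1 mulnC leq_subr.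
- by rewrite p0 (ltnW m2).
- by rewrite leq_pmull ?(ltnW m2).
Qed.
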